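(* Consider a nonatomic mixed-autonomy congestion game with cost function drawn from the class $\mathcal{C}_{k,\sigma}$. Let $z^{\mathrm{EQ}}$ be an equilibrium and $z^{\mathrm{OPT}}$ a social optimum for this game, and let $\xi(\sigma)=\sigma(\sigma+1)^{-\frac{\sigma+1}{\sigma}}$. If $k\,\xi(\sigma)<1$, then $$C(z^{\mathrm{EQ}})\le \frac{1}{1-k\,\xi(\sigma)}\,C(z^{\mathrm{OPT}}).$$
   Context: Game: a directed network with $n$ roads (links) and $m$ origin-destination pairs; the $j$-th pair has demand $\alpha_j\ge 0$ of human-driven flow and $\beta_j\ge 0$ of autonomous flow. Drivers are nonatomic. A routing is a vector $z=(x_1,y_1,\ldots,x_n,y_n)\in\mathbb{R}_{\ge 0}^{2n}$, where $x_i,y_i$ are the human-driven and autonomous flows on road $i$; it is feasible if it routes all demand of both types from origins to destinations, respecting conservation of flow. Both vehicle types on road $i$ experience latency $c_i(x_i,y_i)$. The social cost is $C(z)=\sum_{i=1}^n c_i(x_i,y_i)(x_i+y_i)$. A (Wardrop) equilibrium is a feasible routing in which all users sharing an origin and destination use paths of equal latency and no unused path has smaller latency. A social optimum is a feasible routing minimizing $C$. Cost functions: the latency on road $i$ is $$c_i(x_i,y_i)=t_i\Big(1+\rho_i\Big(\tfrac{x_i+y_i}{m_i(x_i,y_i)}\Big)^{\sigma_i}\Big),\qquad t_i\ge 0,\ \rho_i\ge 0,\ \sigma_i\ge 1,$$ where, with $\alpha(x_i,y_i)=y_i/(x_i+y_i)$ and constants $d_i,h_i,\bar h_i>0$ (road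 length, nonplatooned spacing, platooned spacing; no order between $h_i$ and $\bar h_i$ is assumed), the capacity $m_i$ is given by either capacity model 1, $$m_i(x_i,y_i)=\frac{d_i}{\alpha(x_i,y_i)\bar h_i+(1-\alpha(x_i,y_i))h_i},$$ or capacity model 2, $$m_i(x_i,y_i)=\frac{d_i}{\alpha^2(x_i,y_i)\bar h_i+(1-\alpha^2(x_i,y_i))h_i}.$$ At $x_i=y_i=0$ the quotient $(x_i+y_i)/m_i(x_i,y_i)$ is taken to be $0$. The maximum degree of asymmetry is $k=\max_{i}\max(h_i/\bar h_i,\ \bar h_i/h_i)$ and the maximum polynomial degree is $\sigma=\max_i\sigma_i$ (maxima over all roads). $\mathcal{C}_{k,\sigma}$ is the class of network cost functions whose road latencies are $c_i(x_i,y_i)=t_i\big(1+\rho_i\big(\tfrac{x_i+y_i}{m_i(x_i,y_i)}\big)^{\sigma_i}\big)$ with $t_i\ge 0$, $\rho_i\ge 0$, $\sigma_i\ge 1$ and $m_i$ given by capacity model 1 or capacity model 2, with maximum degree of asymmetry $k$ and maximum polynomial degree $\sigma$. *)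

(* Defs.v *)
From HB Require Import structures.
From mathcomp Require Import all_boot all_order all_algebra.
From mathcomp Require Import all_classical all_reals all_analysis.

Set Implicit Arguments.
Unset Strict Implicit.
Unset Printing Implicit Defensive.

Import Order.TTheory GRing.Theory Num.Theory.

Local Open Scope ring_scope.

(* Parallel roads and loops are allowed, and distinct indices j may share the
   same origin and destination. *)
Record game (R : realType) (V : finType) (n m : nat) := Game {
  tail : 'I_n -> V;
  head : 'I_n -> V;
  orig : 'I_m -> V;
  dest : 'I_m -> V;
  hum_demand : 'I_m -> R;
  aut_demand : 'I_m -> R;
  hum_demand_ge0 : forall j, 0 <= hum_demand j;
  aut_demand_ge0 : forall j, 0 <= aut_demand j
}.

(* (z i).1 is the human-driven flow x_i, (z i).2 the autonomous flow y_i. *)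
Definition routing (R : realType) (n : nat) := 'I_n -> R * R.

(* c i x y is the latency of road i at flows (x, y). *)
Definition costs (R : realType) (n : nat) := 'I_n -> R -> R -> R.

Definition social_cost (R : realType) (n : nat) (c : costs R n)
    (z : routing R n) : R :=
  \sum_(i < n) c i (z i).1 (z i).2 * ((z i).1 + (z i).2).

Section Network.
Context (R : realType) (V : finType) (n m : nat) (G : game R V n m).
Implicit Types (u v w : V) (p q : seq 'I_n) (j : 'I_m).

(* f carries an amount dem of flow from u to w: the net outflow is dem at u,
   -dem at w and 0 elsewhere (0 everywhere if u = w). *)
Definition carries u w (dem : R) (f : 'I_n -> R) : Prop :=
  (forall i, 0 <= f i) /\
  forall v, \sum_(i < n | tail G i == v) f i - \sum_(i < n | head G i == v) f i
            = dem * ((v == u)%:R - (v == w)%:R).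

Definition feasible (z : routing R n) : Prop :=
  exists fh fa : 'I_m -> 'I_n -> R,
    [/\ forall j, carries (orig G j) (dest G j) (hum_demand G j) (fh j),
        forall j, carries (orig G j) (dest G j) (aut_demand G j) (fa j) &
        forall i, z i = (\sum_(j < m) fh j i, \sum_(j < m) fa j i)].

Fixpoint walk u p w : bool :=
  if p is i :: p' then (tail G i == u) && walk (head G i) p' w else u == w.

(* A path is a walk that repeats no vertex. *)
Definition od_path j p : bool :=
  walk (orig G j) p (dest G j) && uniq (orig G j :: map (head G) p).

(* A path repeats no road either, so every path belongs to the finite type
   n.-bseq 'I_n of sequences of at most n roads. *)
Definition path_flow := 'I_m -> n.-bseq 'I_n -> R.

Definition assigns (dem : 'I_m -> R) (F : path_flow) : Prop :=
  (forall j (p : n.-bseq 'I_n), 0 <= F j p) /\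
  (forall j, \sum_(p : n.-bseq 'I_n | od_path j p) F j p = dem j).

Definition road_flow (F : path_flow) (i : 'I_n) : R :=
  \sum_(j < m) \sum_(p : n.-bseq 'I_n | od_path j p && (i \in p)) F j p.

Definition path_latency (c : costs R n) (z : routing R n) p : R :=
  \sum_(i <- p) c i (z i).1 (z i).2.

Definition used (Fh Fa : path_flow) j (p : n.-bseq 'I_n) : Prop :=
  od_path j p /\ (0 < Fh j p \/ 0 < Fa j p).

(* For indices j, j' with the same origin and destination, the condition for
   each of them forces their used paths to have equal latency as well. *)
Definition equilibrium (c : costs R n) (z : routing R n) : Prop :=
  feasible z /\
  exists Fh Fa : path_flow,
    [/\ assigns (hum_demand G) Fh,
        assigns (aut_demand G) Fa,
        forall i, z i = (road_flow Fh i, road_flow Fa i) &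
        forall j (p q : n.-bseq 'I_n), used Fh Fa j p -> od_path j q ->
          (used Fh Fa j q -> path_latency c z p = path_latency c z q) /\
          (~ used Fh Fa j q -> path_latency c z p <= path_latency c z q)].

Definition social_optimum (c : costs R n) (z : routing R n) : Prop :=
  feasible z /\ forall z', feasible z' -> social_cost c z <= social_cost c z'.

End Network.

Inductive capacity_model := Model1 | Model2.

Record road (R : realType) := Road {
  free_latency : R;         (* t *)
  congestion : R;           (* rho *)
  degree : R;               (* sigma *)
  len : R;                  (* d *)
  spacing : R;              (* h, nonplatooned *)
  platoon_spacing : R;      (* hbar, platooned *)
  model : capacity_model
}.

Definition valid_road (R : realType) (r : road R) : Prop :=
  [/\ 0 <= free_latency r, 0 <= congestion r & 1 <= degree r] /\
  [/\ 0 < len r, 0 < spacing r & 0 < platoon_spacing r].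

Section Latency.
Context (R : realType) (r : road R).

Definition autonomy (x y : R) : R := y / (x + y).

Definition capacity (x y : R) : R :=
  let a := match model r with
           | Model1 => autonomy x y
           | Model2 => autonomy x y ^+ 2
           end in
  len r / (a * platoon_spacing r + (1 - a) * spacing r).

(* At x = y = 0 the quotient (x + y) / capacity x y is 0, as intended, because
   0 / 0 = 0 makes capacity 0 0 = len / spacing. *)
Definition latency (x y : R) : R :=
  free_latency r *
    (1 + congestion r * ((x + y) / capacity x y) `^ degree r).

Definition asymmetry : R :=
  Num.max (spacing r / platoon_spacing r) (platoon_spacing r / spacing r).

End Latency.

(* For valid roads all asymmetries and degrees are at least 1, so the default
   value 0 of the maxima matters only when n = 0. *)
Definition max_asymmetry (R : realType) (n : nat) (r : 'I_n -> road R) : R :=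
  \big[Num.max/0]_(i < n) asymmetry (r i).

Definition max_degree (R : realType) (n : nat) (r : 'I_n -> road R) : R :=
  \big[Num.max/0]_(i < n) degree (r i).

(* Only the values at nonnegative flows matter. *)
Definition cost_class (R : realType) (n : nat) (k sigma : R)
    (c : costs R n) : Prop :=
  exists r : 'I_n -> road R,
    [/\ forall i, valid_road (r i),
        forall i x y, 0 <= x -> 0 <= y -> c i x y = latency (r i) x y,
        max_asymmetry r = k &
        max_degree r = sigma].

Definition xi (R : realType) (sigma : R) : R :=
  sigma * (sigma + 1) `^ (- ((sigma + 1) / sigma)).

(* Main.v *)
Require Import Defs.
From mathcomp Require Import all_boot all_order all_algebra.
From mathcomp Require Import all_classical all_reals all_analysis.
From mathcomp Require Import ring lra.

Set Implicit Arguments.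
Unset Strict Implicit.
Unset Printing Implicit Defensive.

Import Order.TTheory GRing.Theory Num.Theory.

Local Open Scope ring_scope.

(** Write s_i = x_i + y_i for the total flow on road i and g_i for the quotient
s_i / m_i.  The bound compares an equilibrium z with an arbitrary feasible
routing z' and has two independent halves.

At the latencies produced by the equilibrium, every used path is a shortest
path, so no feasible routing is cheaper when these latencies are held fixed:
C(z) <= sum_i c_i(z) s'_i ([equilibrium_variational]).  The equilibrium comes
with path flows while z' only has flows satisfying conservation on the roads;
no path decomposition of z' is built.  Instead the shortest path distance from
an origin is a potential whose increase along a road is at most the latency of
that road, and pairing a flow with a potential difference telescopes
([carries_cost_ge]).

The second half is a road-by-road estimate ([latency_gap])
  (c_i(z) - c_i(z')) s'_i <= k xi(sigma) c_i(z) s_i.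
Under either capacity model g_i / s_i is, up to the road length, a convex
combination of the two spacings, so that s'_i g_i <= k s_i g'_i
([load_exchange]); this is where the asymmetry enters.  With u = g'_i / g_i, what
remains is that u (1 - u^sigma) <= xi(sigma), which is Young's inequality
([le_powRD1_xi]).

Summing the second estimate and combining it with the first one gives
C(z) <= C(z') + k xi(sigma) C(z), whence the bound. *)

(** * The constant xi and Young's inequality *)

Lemma xi_ge0 (R : realType) (sigma : R) : 0 <= sigma -> 0 <= xi sigma.
Proof. by move=> s0; rewrite mulr_ge0 ?powR_ge0. Qed.

(** This says that xi sigma bounds u - u^(sigma+1), whose maximum over u >= 0 it
is, attained at u = (sigma+1)^(-1/sigma).  Young's inequality with the conjugate
exponents sigma+1 and (sigma+1)/sigma, applied to the product of u and
1/(sigma+1), gives exactly this bound. *)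
Lemma le_powRD1_xi (R : realType) (sigma u : R) :
  0 < sigma -> 0 <= u -> u <= u `^ (sigma + 1) + xi sigma.
Proof.
move=> s0 u0; set p := sigma + 1.
have p0 : 0 < p by rewrite addr_gt0.
have q0 : 0 < p / sigma by rewrite divr_gt0.
have pq : p^-1 + (p / sigma)^-1 = 1.
  by rewrite invf_div -{1}(mul1r p^-1) -mulrDl addrC divff ?gt_eqF.
have b0 : 0 <= p^-1 by rewrite invr_ge0 ltW.
have := conjugate_powR u0 b0 p0 q0 pq.
rewrite -(ler_pM2r p0) divfK ?gt_eqF// mulrDl divfK ?gt_eqF//.
suff -> : p^-1 `^ (p / sigma) / (p / sigma) * p = xi sigma by [].
rewrite invf_div -mulrA divfK ?gt_eqF// mulrC.
by rewrite -(powR_inv1 (ltW p0)) -powRrM mulN1r.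
Qed.

(** The scale-invariant form of the previous bound, with u = g'/g.  Passing from
the degree s of one road to the maximal degree sigma uses that u^s decreases
in s for u in ]0, 1]. *)
Lemma powR_gap (R : realType) (s sigma g g' : R) :
  0 < s -> s <= sigma -> 0 <= g' -> g' <= g ->
  (g `^ s - g' `^ s) * g' <= xi sigma * (g `^ s * g).
Proof.
move=> s0 ssig g'0 g'g.
have sig0 : 0 < sigma by exact: lt_le_trans ssig.
have [->|g'N0] := eqVneq g' 0.
  by rewrite mulr0 !mulr_ge0 ?xi_ge0 ?powR_ge0 ?(ltW sig0)// (le_trans g'0).
have {g'0 g'N0} g'0 : 0 < g' by rewrite lt0r g'N0.
have g0 : 0 < g by exact: lt_le_trans g'g.
set u := g' / g.
have u0 : 0 < u by rewrite divr_gt0.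
have u1 : u <= 1 by rewrite ler_pdivrMr// mul1r.
have -> : g' = u * g by rewrite divfK ?gt_eqF.
rewrite powRM ?(ltW u0) ?(ltW g0)//.
have -> : (g `^ s - u `^ s * g `^ s) * (u * g)
    = ((1 - u `^ s) * u) * (g `^ s * g) by ring.
rewrite ler_wpM2r ?mulr_ge0 ?powR_ge0 ?(ltW g0)//.
apply: (@le_trans _ _ ((1 - u `^ sigma) * u)).
  by rewrite ler_wpM2r ?(ltW u0)// lerD2l lerN2 ger_powR ?u0.
have := le_powRD1_xi sig0 (ltW u0).
rewrite powRD ?(gt_eqF u0) ?implybT// powRr1 ?(ltW u0)//; lra.
Qed.

(** * Latency on a single road *)

(** The average spacing is a convex combination of the two spacings, the weight
being the autonomy ratio or its square: the two capacity models need no further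
distinction. *)
Lemma load_bounds (R : realType) (r : road R) (x y : R) :
  valid_road r -> 0 <= x -> 0 <= y ->
  Num.min (spacing r) (platoon_spacing r) * (x + y)
    <= (x + y) / capacity r x y * len r
    <= Num.max (spacing r) (platoon_spacing r) * (x + y).
Proof.
case=> _ [d0 h0 b0] x0 y0; rewrite /capacity.
set a := match model r with Model1 => _ | Model2 => _ end.
have aut01 : 0 <= autonomy x y <= 1.
  rewrite /autonomy divr_ge0 ?addr_ge0//=.
  (* On an empty road the ratio is 0 / 0 = 0, which is also in [0, 1]. *)
  have [->|N0] := eqVneq (x + y) 0; first by rewrite invr0 mulr0.
  by rewrite ler_pdivrMr ?mul1r ?lerDr// lt0r N0 addr_ge0.
have a01 : 0 <= a <= 1.
  rewrite /a; case: (model r) => //.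
  by case/andP: aut01 => ? ?; rewrite exprn_ge0// exprn_ile1.
have s0 : 0 <= x + y by rewrite addr_ge0.
rewrite invf_div mulrA divfK ?gt_eqF// [_ * (_ + _ * spacing r)]mulrC.
case/andP: a01 => a0 a1.
by rewrite !ler_wpM2r//; case: (leP (spacing r)) => ?; nra.
Qed.

Lemma max_eq_asymmetryM (R : realType) (r : road R) :
  valid_road r ->
  Num.max (spacing r) (platoon_spacing r)
    = asymmetry r * Num.min (spacing r) (platoon_spacing r).
Proof.
case=> _ [_ h0 b0]; rewrite /asymmetry.
case: (leP (spacing r)) => hb.
  rewrite max_r ?divfK ?gt_eqF//.
  by apply: (@le_trans _ _ 1); rewrite ?ler_pdivrMr ?ler_pdivlMr// mul1r.
rewrite max_l ?divfK ?gt_eqF//.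
by apply: (@le_trans _ _ 1); rewrite ?ler_pdivrMr ?ler_pdivlMr// mul1r ltW.
Qed.

Lemma asymmetry_ge0 (R : realType) (r : road R) :
  valid_road r -> 0 <= asymmetry r.
Proof. by case=> _ [_ h0 b0]; rewrite le_max divr_ge0// ltW. Qed.

(** Per unit of flow, the loads of two flow profiles on the same road differ at
most by a factor equal to the ratio of the larger spacing to the smaller. *)
Lemma load_exchange (R : realType) (r : road R) (x y x' y' : R) :
  valid_road r -> 0 <= x -> 0 <= y -> 0 <= x' -> 0 <= y' ->
  (x' + y') * ((x + y) / capacity r x y)
    <= asymmetry r * (x + y) * ((x' + y') / capacity r x' y').
Proof.
move=> rv x0 y0 x'0 y'0.
have /andP[_] := load_bounds rv x0 y0; rewrite max_eq_asymmetryM//.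
have /andP[+ _] := load_bounds rv x'0 y'0.
have k0 := asymmetry_ge0 rv.
case: (rv) => _ [d0 h0 b0].
set M := Num.min _ _; set g := _ / capacity _ x y; set g' := _ / capacity _ _ _.
set s := x + y; set s' := x' + y' => lo hi.
have M0 : 0 < M by rewrite lt_min h0.
rewrite -(ler_pM2r d0) -(ler_pM2r M0).
have s0 : 0 <= s by exact: addr_ge0.
have s'0 : 0 <= s' by exact: addr_ge0.
apply: (@le_trans _ _ (s' * (asymmetry r * M * s) * M)).
  by rewrite ler_wpM2r ?(ltW M0)// -[leLHS]mulrA ler_wpM2l.
have -> : s' * (asymmetry r * M * s) * M = asymmetry r * s * M * (M * s').
  by ring.
have -> : asymmetry r * s * g' * len r * M = asymmetry r * s * M * (g' * len r).
  by ring.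
by rewrite ler_wpM2l// !mulr_ge0// ltW.
Qed.

Lemma load_ge0 (R : realType) (r : road R) (x y : R) :
  valid_road r -> 0 <= x -> 0 <= y -> 0 <= (x + y) / capacity r x y.
Proof.
move=> rv x0 y0; have /andP[+ _] := load_bounds rv x0 y0.
case: rv => _ [d0 h0 b0] lo; rewrite -(pmulr_lge0 _ d0).
by apply: le_trans lo; rewrite mulr_ge0 ?addr_ge0// le_min !ltW.
Qed.

Lemma latency_ge0 (R : realType) (r : road R) (x y : R) :
  valid_road r -> 0 <= latency r x y.
Proof.
by case=> [] [t0 rho0 _] _; rewrite mulr_ge0// addr_ge0// mulr_ge0// powR_ge0.
Qed.

(** If the load g' at (x', y') is at least the load g at (x, y), the left-hand
side is nonpositive.  Otherwise the constant part of the latency cancels and,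
after multiplying by g, [load_exchange] replaces s' g by k s g', which leaves
the expression bounded in [powR_gap]. *)
Lemma latency_gap (R : realType) (r : road R) (k sigma x y x' y' : R) :
  valid_road r -> asymmetry r <= k -> degree r <= sigma ->
  0 <= x -> 0 <= y -> 0 <= x' -> 0 <= y' ->
  (latency r x y - latency r x' y') * (x' + y')
    <= k * xi sigma * (latency r x y * (x + y)).
Proof.
move=> rv rk rsig x0 y0 x'0 y'0.
have ex := load_exchange rv x0 y0 x'0 y'0.
have g0 := load_ge0 rv x0 y0.
have g'0 := load_ge0 rv x'0 y'0.
have kr0 := asymmetry_ge0 rv.
have k0 : 0 <= k by exact: le_trans rk.
have lat0 := latency_ge0 x y rv.
case: (rv) => [[t0 rho0 s1] _].
have xi0 : 0 <= xi sigma by rewrite xi_ge0//; lra.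
move: ex g0 g'0 lat0; rewrite /latency.
set g := _ / capacity _ x y; set g' := _ / capacity _ _ _.
set s := x + y; set s' := x' + y' => ex g0 g'0 lat0.
have S0 : 0 <= s by exact: addr_ge0.
have S'0 : 0 <= s' by exact: addr_ge0.
set t := free_latency r; set rho := congestion r; set e := degree r.
have e0 : 0 <= e by exact: le_trans s1.
have -> : (t * (1 + rho * g `^ e) - t * (1 + rho * g' `^ e)) * s'
    = t * rho * ((g `^ e - g' `^ e) * s') by ring.
have [gg'|g'g] := leP g g'.
  apply: (@le_trans _ _ 0); last by do 2! apply: mulr_ge0.
  apply: mulr_ge0_le0; first exact: mulr_ge0.
  apply: mulr_le0_ge0 => //; rewrite subr_le0.
  by rewrite ge0_ler_powR ?nnegrE.
have {}g0 : 0 < g by exact: le_lt_trans g'g.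
suff H : (g `^ e - g' `^ e) * s' <= k * xi sigma * (g `^ e * s).
  have -> : k * xi sigma * (t * (1 + rho * g `^ e) * s)
    = k * xi sigma * (t * s) + t * rho * (k * xi sigma * (g `^ e * s)) by ring.
  apply: ler_wpDl; first by do 2! apply: mulr_ge0.
  by rewrite ler_wpM2l// mulr_ge0.
have P0 : 0 <= g `^ e by exact: powR_ge0.
have dP0 : 0 <= g `^ e - g' `^ e.
  by rewrite subr_ge0 ge0_ler_powR ?nnegrE// ltW.
rewrite -(ler_pM2r g0).
apply: (@le_trans _ _ (asymmetry r * s * ((g `^ e - g' `^ e) * g'))).
  have -> : asymmetry r * s * ((g `^ e - g' `^ e) * g') =
    (g `^ e - g' `^ e) * (asymmetry r * s * g') by ring.
  by rewrite -[leLHS]mulrA ler_wpM2l.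
have -> : k * xi sigma * (g `^ e * s) * g = k * s * (xi sigma * (g `^ e * g)).
  by ring.
apply: (@le_trans _ _ (asymmetry r * s * (xi sigma * (g `^ e * g)))).
  by rewrite ler_wpM2l ?mulr_ge0// powR_gap ?(lt_le_trans ltr01 s1)// ltW.
apply: ler_wpM2r; last exact: ler_wpM2r.
by do 2! apply: mulr_ge0 => //; exact: ltW.
Qed.

(** * Walks and simple paths *)

Section Network.
Context (R : realType) (V : finType) (n m : nat) (G : game R V n m).

(** Generalizes [od_path], which is the case of the endpoints of an
origin-destination pair, to arbitrary endpoints: the potential below needs
distances to every vertex. *)
Definition simple_path (u w : V) (p : seq 'I_n) : bool :=
  walk G u p w && uniq (u :: map (Defs.head G) p).

Lemma simple_path_uniq u w p : simple_path u w p -> uniq p.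
Proof. by case/andP=> _ /= /andP[_] /map_uniq. Qed.

(** Simple paths therefore range over a finite type, as needed to minimize over
them. *)
Lemma simple_path_size u w p : simple_path u w p -> (size p <= n)%N.
Proof.
move=> /simple_path_uniq up.
by rewrite -(card_uniqP up) -[leqRHS]card_ord max_card.
Qed.

Lemma walk_cat u v w p q : walk G u p v -> walk G v q w -> walk G u (p ++ q) w.
Proof.
elim: p u => [|i p IH] u /=; first by move/eqP->.
by move=> /andP[-> /IH].
Qed.

Lemma simple_path_suffix u v w p :
  simple_path u w p -> v \in u :: map (Defs.head G) p ->
  exists2 q, simple_path v w q & subseq q p.
Proof.
elim: p u => [|i p IH] u sp.
  by rewrite inE => /eqP ->; exists [::].
rewrite inE.
case/predU1P => [->|vp]; first by exists (i :: p).
have [|q sq qp] := IH (Defs.head G i) _ vp.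
  by case/andP: sp => /= /andP[_ Hw] /andP[_ Hu]; apply/andP.
by exists q => //; apply: subseq_trans qp _; exact: subseq_cons.
Qed.

(** Loop erasure, from the end of the walk backwards: prepending a road to a
simple path closes at most one loop, which is removed by keeping only the part
of the path that follows it. *)
Lemma walk_simple_path u w p :
  walk G u p w -> exists2 q, simple_path u w q & subseq q p.
Proof.
elim: p u => [|i p IH] u.
  by move=> uw; exists [::] => //; apply/andP.
case/andP=> ti /IH[q sq qp].
have [uq|uq] := boolP (u \in Defs.head G i :: map (Defs.head G) q).
  have [q' sq' q'q] := simple_path_suffix sq uq; exists q' => //.
  by apply: subseq_trans q'q _; apply: subseq_trans qp _; exact: subseq_cons.
exists (i :: q); last by rewrite /= eqxx.
by case/andP: sq => Hw Hu; rewrite /simple_path /= ti Hw/= uq.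
Qed.

End Network.

(** * Shortest path potentials *)

Lemma ler_sum_subseq (R : realType) (I : eqType) (w : I -> R) (s t : seq I) :
  (forall i, 0 <= w i) -> subseq s t ->
  \sum_(i <- s) w i <= \sum_(i <- t) w i.
Proof.
move=> w0; elim: t s => [|j t IH] s; first by rewrite subseq0 => /eqP ->.
case: s => [_|i s]; first by rewrite big_nil sumr_ge0.
rewrite big_cons [leRHS]big_cons /=; have [->|_] := eqVneq i j => st.
  by rewrite lerD2l IH.
by rewrite -(big_cons 0 _ i s xpredT w) ler_wpDl// IH.
Qed.

Section Duality.
Context (R : realType) (V : finType) (n m : nat) (G : game R V n m).
Context (w : 'I_n -> R) (w_ge0 : forall i, 0 <= w i).

(** The cap L gives a value to the vertices that cannot be reached from u, while
keeping the triangle inequality [dist_head] along every road. *)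
Definition dist (L : R) (u v : V) : R :=
  \big[Num.min/L]_(p : n.-bseq 'I_n | simple_path G u v p) \sum_(i <- p) w i.

Lemma dist_le_walk L u v p : walk G u p v -> dist L u v <= \sum_(i <- p) w i.
Proof.
move=> /walk_simple_path[q sq qp].
have qn : (size q <= n)%N by exact: simple_path_size sq.
apply: (@bigmin_inf _ _ _ _ (Bseq qn)) => //.
exact: ler_sum_subseq.
Qed.

Lemma dist_head L u i : dist L u (Defs.head G i) <= dist L u (tail G i) + w i.
Proof.
rewrite -lerBlDr; apply/bigmin_geP; split=> [|p /andP[Hw _]].
  by rewrite lerBlDr ler_wpDr// bigmin_le_id.
rewrite lerBlDr.
have -> : w i = \sum_(j <- [:: i]) w j by rewrite big_seq1.
rewrite -big_cat; apply: dist_le_walk; apply: walk_cat Hw _.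
by rewrite /= !eqxx.
Qed.

(** Summation by parts: grouping the roads by their endpoints turns the pairing
with a potential difference into the pairing of the net outflow with the
potential. *)
Lemma carries_potential (u v : V) (dem : R) (f : 'I_n -> R) (phi : V -> R) :
  carries G u v dem f ->
  \sum_(i < n) f i * (phi (Defs.head G i) - phi (tail G i))
    = dem * (phi v - phi u).
Proof.
case=> _ fc.
have regroup (e : 'I_n -> V) :
    \sum_(i < n) f i * phi (e i) = \sum_x (\sum_(i < n | e i == x) f i) * phi x.
  rewrite (partition_big e xpredT)//; apply: eq_bigr => x _.
  by rewrite mulr_suml; apply: eq_bigr => i /eqP <-.
under eq_bigr do rewrite mulrBr.
rewrite sumrB !regroup -opprB -sumrB.
under eq_bigr do rewrite -mulrBl fc.
have pick y : \sum_x (x == y)%:R * phi x = phi y.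
  rewrite (bigD1 y)//= eqxx mul1r big1 ?addr0// => x /negbTE ->.
  by rewrite mul0r.
under eq_bigr do rewrite -mulrA mulrBl.
by rewrite -mulr_sumr sumrB !pick -mulrN opprB.
Qed.

(** Weak duality between flows and distances.  The distance capped at L is L at
the destination, 0 at the origin and increases by at most the weight along each
road.  This also covers u = v, where the hypothesis on L, read on the empty
path, forces L = 0. *)
Lemma carries_cost_ge u v (dem L : R) (f : 'I_n -> R) :
  0 <= L -> 0 <= dem ->
  (forall p, simple_path G u v p -> L <= \sum_(i <- p) w i) ->
  carries G u v dem f -> dem * L <= \sum_(i < n) f i * w i.
Proof.
move=> L0 dem0 HL fc.
have dv : L <= dist L u v by apply/bigmin_geP; split=> // p; exact: HL.
have du : dist L u u <= 0.
  by have := @dist_le_walk L u u [::]; rewrite big_nil /= eqxx; exact.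
apply: (@le_trans _ _ (dem * (dist L u v - dist L u u))).
  by rewrite ler_wpM2l//; lra.
rewrite -(carries_potential _ fc).
apply: ler_sum => i _; rewrite ler_wpM2l ?fc.1// lerBlDl.
exact: dist_head.
Qed.

End Duality.

(** * Equilibria as shortest path routings *)

Section Equilibrium.
Context (R : realType) (V : finType) (n m : nat) (G : game R V n m).

(** Exchanging the sums over roads and paths; a path repeats no road, so its
latency is also a sum over the set of its roads. *)
Lemma road_flow_cost (dem : 'I_m -> R) (F : path_flow R n m) (L : 'I_m -> R)
    (w : 'I_n -> R) :
  assigns G dem F ->
  (forall j (p : n.-bseq 'I_n), od_path G j p -> 0 < F j p ->
     \sum_(i <- p) w i = L j) ->
  \sum_(i < n) road_flow G F i * w i = \sum_(j < m) dem j * L j.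
Proof.
case=> F0 Fd FL.
under eq_bigr do rewrite mulr_suml.
rewrite exchange_big /=; apply: eq_bigr => j _.
under eq_bigr do rewrite mulr_suml big_mkcondr /=.
rewrite exchange_big /= -Fd mulr_suml; apply: eq_bigr => p jp.
have up : uniq p by exact: (simple_path_uniq jp).
rewrite -big_mkcond /= -mulr_sumr -big_uniq//.
have := F0 j p; rewrite le_eqVlt => /predU1P[<-|Fp]; first by rewrite !mul0r.
by rewrite (FL j).
Qed.

Lemma feasible_ge0 (z : routing R n) i :
  feasible G z -> 0 <= (z i).1 /\ 0 <= (z i).2.
Proof.
case=> fh [fa [fhc fac ->]] /=.
by split; apply: sumr_ge0 => j _; [exact: (fhc j).1|exact: (fac j).1].
Qed.

(** A pair without demand has no used path and hence no common latency, but then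
any L below the latencies of its paths serves, and 0 does. *)
Lemma equilibrium_latency (c : costs R n) (z : routing R n)
    (Fh Fa : path_flow R n m) j :
  (forall i, 0 <= c i (z i).1 (z i).2) ->
  (forall (p q : n.-bseq 'I_n), used G Fh Fa j p -> od_path G j q ->
     (used G Fh Fa j q -> path_latency c z p = path_latency c z q) /\
     (~ used G Fh Fa j q -> path_latency c z p <= path_latency c z q)) ->
  exists L, [/\ 0 <= L,
    forall p, od_path G j p -> L <= path_latency c z p &
    forall p : n.-bseq 'I_n, used G Fh Fa j p -> path_latency c z p = L].
Proof.
move=> c0 eqj.
have [[p up]|nu] := pselect (exists p, used G Fh Fa j p); last first.
  exists 0; split=> // [p _|p up]; first exact: sumr_ge0.
  by case: nu; exists p.
exists (path_latency c z p); split=> [|q jq|q uq].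
- exact: sumr_ge0.
- have qn : (size q <= n)%N by exact: simple_path_size jq.
  have [e le] := eqj p (Bseq qn) up jq.
  by have [/e->|/le] := pselect (used G Fh Fa j (Bseq qn)).
- by rewrite (eqj p q up uq.1).1.
Qed.

(** Both sides are compared with the sum over the pairs j of the total demand
times the common latency L j: the equilibrium attains it, and every feasible
routing costs at least as much. *)
Lemma equilibrium_variational (c : costs R n) (z z' : routing R n) :
  (forall i, 0 <= c i (z i).1 (z i).2) ->
  equilibrium G c z -> feasible G z' ->
  social_cost c z
    <= \sum_(i < n) c i (z i).1 (z i).2 * ((z' i).1 + (z' i).2).
Proof.
move=> c0 [_ [Fh [Fa [aFh aFa zE eqz]]]] [fh [fa [fhc fac z'E]]].
pose w i := c i (z i).1 (z i).2.
have /choice[L HL] j := equilibrium_latency c0 (eqz j).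
have L0 j : 0 <= L j by case: (HL j).
have Lmin j p : od_path G j p -> L j <= \sum_(i <- p) w i.
  by case: (HL j) => _ + _; exact.
have -> : social_cost c z
    = \sum_(j < m) (hum_demand G j * L j + aut_demand G j * L j).
  rewrite big_split /= -(road_flow_cost (w := w) aFh); last first.
    by move=> j p jp Fp; case: (HL j) => _ _; apply; split=> //; left.
  rewrite -(road_flow_cost (w := w) aFa); last first.
    by move=> j p jp Fp; case: (HL j) => _ _; apply; split=> //; right.
  rewrite -big_split /=; apply: eq_bigr => i _.
  by rewrite -mulrDl mulrC /w !zE.
have -> : \sum_(i < n) c i (z i).1 (z i).2 * ((z' i).1 + (z' i).2)
    = \sum_(j < m) (\sum_(i < n) fh j i * w i + \sum_(i < n) fa j i * w i).
  rewrite big_split /= [X in _ = X + _]exchange_big [X in _ = _ + X]exchange_big.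
  rewrite -big_split /=; apply: eq_bigr => i _.
  by rewrite z'E /= -!mulr_suml -mulrDl mulrC.
apply: ler_sum => j _; apply: lerD.
  apply: (carries_cost_ge _ _ _ _ (fhc j)) => //; first exact: hum_demand_ge0.
  exact: Lmin.
apply: (carries_cost_ge _ _ _ _ (fac j)) => //; first exact: aut_demand_ge0.
exact: Lmin.
Qed.

End Equilibrium.

Theorem theorem2 (R : realType) (V : finType) (n m : nat)
    (G : game R V n m) (k sigma : R) (c : costs R n)
    (zEQ zOPT : routing R n) :
  cost_class k sigma c ->
  equilibrium G c zEQ ->
  social_optimum G c zOPT ->
  k * xi sigma < 1 ->
  social_cost c zEQ <= 1 / (1 - k * xi sigma) * social_cost c zOPT.
Proof.
move=> [r [rv cE kE sE]] eqz [fopt _] kxi.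
have eq0 i := feasible_ge0 i eqz.1.
have opt0 i := feasible_ge0 i fopt.
have c0 i : 0 <= c i (zEQ i).1 (zEQ i).2.
  by case: (eq0 i) => ? ?; rewrite cE// latency_ge0.
have gap : \sum_(i < n) c i (zEQ i).1 (zEQ i).2 * ((zOPT i).1 + (zOPT i).2)
    <= social_cost c zOPT + k * xi sigma * social_cost c zEQ.
  rewrite /social_cost mulr_sumr -big_split /=; apply: ler_sum => i _.
  case: (eq0 i) (opt0 i) => x0 y0 [x'0 y'0].
  rewrite !cE// -lerBlDl -mulrBl latency_gap//.
    by rewrite -kE; exact: le_bigmax.
  by rewrite -sE; exact: le_bigmax.
have vi := equilibrium_variational c0 eqz fopt.
rewrite mul1r mulrC ler_pdivlMr ?subr_gt0//; lra.
Qed.
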